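(* Let $\mathcal{V}$ be a finite collection of vectors $v_1,\dots,v_h\in\mathbb{R}^n$, and for each $v\in\mathcal{V}$ let $\beta_v\ge 0$ be a non-negative multiplier. Consider the symmetric matrix \[ B=\sum_{v\in\mathcal{V}}\beta_v\left(vv^T-2\sum_{i=1}^n\langle v,e_i\rangle^2 e_ie_i^T\right), \] where $e_1,\dots,e_n$ is the standard basis of $\mathbb{R}^n$. Then there exists a linear subspace $W\subseteq\mathbb{R}^n$ with $\dim(W)\ge n/2$ such that $y^TBy\le 0$ for every $y\in W$. *)

(* Defs.v *)
From HB Require Import structures.
From mathcomp Require Export all_boot all_order all_algebra.
From mathcomp Require Export reals.

Set Implicit Arguments.
Unset Strict Implicit.
Unset Printing Implicit Defensive.

Import GRing.Theory Num.Theory.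
Local Open Scope ring_scope.

Definition dotv (R : realType) (n : nat) (u w : 'cV[R]_n) : R :=
  (u^T *m w) 0 0.

Definition stdb (R : realType) (n : nat) (i : 'I_n) : 'cV[R]_n :=
  delta_mx i 0.

Definition Bmx (R : realType) (n h : nat)
    (v : 'I_h -> 'cV[R]_n) (beta : 'I_h -> R) : 'M[R]_n :=
  \sum_(k < h) beta k *:
    (v k *m (v k)^T
     - 2 *: \sum_(i < n) dotv (v k) (stdb R i) ^+ 2 *:
              (stdb R i *m (stdb R i)^T)).

(* Main.v *)
(** Write [X] for the matrix with rows [sqrt (beta_k) v_k] and [D] for the diagonal
    of [X^T X], so that [B = X^T X - 2 D]. Setting [S = sqrt D] we have [X = Y S],
    where the squared entries of [Y] sum to at most [n].  If [B] is positive
    definite on a [p]-dimensional space, then [|Y z|^2 > 2 |z|^2] on the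
    [p]-dimensional image of that space under [S]; summing over an orthogonal basis
    of the image and applying Bessel's inequality to each row of [Y] gives
    [2 p <= n].  Diagonalising [B] by congruence, the common kernel of the
    coordinates with positive coefficient is therefore the desired [W]. *)

Require Import Defs.
From mathcomp Require Import all_boot all_order all_algebra.
From mathcomp Require Import reals zify.

Set Implicit Arguments.
Unset Strict Implicit.
Unset Printing Implicit Defensive.
Import Order.TTheory GRing.Theory Num.Theory.

Local Open Scope ring_scope.

(** * Diagonalisation of symmetric matrices by congruence *)

Lemma symmetric_neq0_anisotropic (R : numFieldType) (n : nat) (A : 'M[R]_n) :
  A^T = A -> A != 0 -> exists u : 'rV[R]_n, (u *m A *m u^T) 0 0 != 0.
Proof.
move=> symA nzA.
have qE i j :
    (delta_mx 0 i *m A *m (delta_mx 0 j)^T) (0 : 'I_1) (0 : 'I_1) = A i j.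
  by rewrite -rowE trmx_delta -colE !mxE.
have [i nzi|diag0] := pickP (fun i => A i i != 0).
  by exists (delta_mx 0 i); rewrite qE.
(* With a zero diagonal, [e_i + e_j] has value [2 A_ij], which is nonzero in characteristic zero. *)
have [[i j] /= nzij|A0] := pickP (fun ij : 'I_n * 'I_n => A ij.1 ij.2 != 0).
  exists (delta_mx 0 i + delta_mx 0 j).
  rewrite linearD /= !mulmxDl !mulmxDr mxE [X in X + _]mxE [X in _ + X]mxE !qE.
  have -> : A j i = A i j by rewrite -{1}symA mxE.
  move/negbFE/eqP: (diag0 i) => ->; move/negbFE/eqP: (diag0 j) => ->.
  by rewrite add0r addr0 -mulr2n mulrn_eq0.
case/eqP: nzA; apply/matrixP => i j; rewrite !mxE.
by move/negbFE/eqP: (A0 (i, j)).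
Qed.

(** Induction on [n]: split off an anisotropic [u]; its [A]-orthogonal complement [K], the kernel of
    [A u^T], has dimension one less, and [A] is block diagonal in the basis [u], [K]. *)
Lemma symmetric_congruent_diag (R : numFieldType) (n : nat) (A : 'M[R]_n) :
  A^T = A ->
  exists2 P : 'M[R]_n, P \in unitmx & exists d, P *m A *m P^T = diag_mx d.
Proof.
elim: n A => [|n IHn] A symA.
  exists 1%:M; first exact: unitmx1.
  by exists 0; apply/matrixP => -[].
have [->|nzA] := eqVneq A 0.
  exists 1%:M; first exact: unitmx1.
  by exists 0; rewrite mulmx0 mul0mx linear0.
have [u nzu] := symmetric_neq0_anisotropic symA nzA.
pose c := A *m u^T.
have nzc : c != 0.
  by apply: contraNneq nzu => c0; rewrite -mulmxA -/c c0 mulmx0 mxE.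
have [K freeK Kc] : exists2 K : 'M[R]_(n, 1 + n), row_free K & K *m c = 0.
  have rk : \rank (kermx c) = n.
    rewrite mxrank_ker; suff -> : \rank c = 1%N by rewrite subn1.
    apply/eqP; rewrite eqn_leq rank_leq_col lt0n mxrank_eq0.
    exact: nzc.
  have Kc : row_base (kermx c) *m c = 0.
    by apply/sub_kermxP; rewrite eq_row_base.
  move: (row_base_free (kermx c)) Kc.
  by move: (row_base (kermx c)); rewrite rk => K; exists K.
pose P : 'M[R]_(1 + n) := col_mx u K.
have unitP : P \in unitmx.
  rewrite -row_free_unit; apply: inj_row_free => x.
  rewrite -[x]hsubmxK; set a := lsubmx x; set b := rsubmx x.
  rewrite mul_row_col => ab0.
  (* Multiplying by [c] kills the [K] part and leaves [a] times the nonzero scalar [u A u^T]. *)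
  have a0 : a = 0.
    have := congr1 (fun y => (y *m c) 0 0) ab0.
    rewrite mulmxDl -!mulmxA Kc mulmx0 addr0 mul0mx [in RHS]mxE.
    rewrite [a]mx11_scalar mul_scalar_mx mxE /c mulmxA => /eqP.
    by rewrite mulf_eq0 (negbTE nzu) orbF => /eqP ->; rewrite raddf0.
  move: ab0; rewrite a0 mul0mx add0r -(mul0mx 1 K) => /(row_free_inj freeK) ->.
  by rewrite mul0mx row_mx0.
have Ku : K *m A *m u^T = 0 by rewrite -mulmxA.
have uK : u *m A *m K^T = 0.
  by apply: trmx_inj; rewrite !trmx_mul symA trmxK mulmxA Ku trmx0.
pose A' := K *m A *m K^T.
have symA' : A'^T = A' by rewrite /A' !trmx_mul symA trmxK mulmxA.
have [Q unitQ [d dE]] := IHn A' symA'.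
have PAP : P *m A *m P^T = block_mx (u *m A *m u^T) 0 0 A'.
  by rewrite /P mul_col_mx tr_col_mx mul_col_row Ku uK.
pose Q1 : 'M[R]_(1 + n) := block_mx 1%:M 0 0 Q.
have unitQ1 : Q1 \in unitmx by rewrite unitmxE det_ublock det1 mul1r -unitmxE.
have QPQ : Q1 *m (P *m A *m P^T) *m Q1^T = diag_mx (row_mx (u *m A *m u^T) d).
  rewrite PAP /Q1 tr_block_mx !mulmx_block trmx1 !trmx0 diag_mx_row.
  rewrite !(mul1mx, mul0mx, mulmx1, mulmx0, addr0, add0r) dE.
  congr block_mx; apply/matrixP => i j.
  by rewrite [RHS]mxE !ord1 eqxx mulr1n.
exists (Q1 *m P); first by rewrite unitmx_mul unitQ1.
by exists (row_mx (u *m A *m u^T) d); rewrite -QPQ trmx_mul !mulmxA.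
Qed.

(** * Squared norms, Bessel's inequality and a dimension bound *)

Definition sqnorm (R : numFieldType) (n : nat) (u : 'rV[R]_n) : R := (u *m u^T) 0 0.

Lemma sqnormE (R : numFieldType) (n : nat) (u : 'rV[R]_n) :
  sqnorm u = \sum_i u 0 i ^+ 2.
Proof. by rewrite /sqnorm mxE; apply: eq_bigr => i _; rewrite mxE expr2. Qed.

Lemma quad_diag (R : numFieldType) (n : nat) (u d : 'rV[R]_n) :
  (u *m diag_mx d *m u^T) 0 0 = \sum_i d 0 i * u 0 i ^+ 2.
Proof.
rewrite mul_mx_diag mxE; apply: eq_bigr => i _.
by rewrite !mxE expr2 mulrCA mulrA.
Qed.

Lemma sqnorm0 (R : numFieldType) (n : nat) : sqnorm (0 : 'rV[R]_n) = 0.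
Proof. by rewrite /sqnorm mul0mx mxE. Qed.

Lemma sqnorm_ge0 (R : realFieldType) (n : nat) (u : 'rV[R]_n) : 0 <= sqnorm u.
Proof. by rewrite sqnormE sumr_ge0 // => i _; rewrite sqr_ge0. Qed.

Lemma sqnorm_eq0 (R : realFieldType) (n : nat) (u : 'rV[R]_n) :
  (sqnorm u == 0) = (u == 0).
Proof.
apply/idP/eqP => [|->]; last by rewrite sqnorm0.
rewrite sqnormE psumr_eq0 => [/allP u0|i _]; last exact: sqr_ge0.
apply/rowP => i; rewrite mxE; apply/eqP.
by have := u0 i (mem_index_enum i); rewrite sqrf_eq0.
Qed.

(** [c *m U] is the orthogonal projection of [w] on the row space of [U], and the residual has
    nonnegative square norm. The rows of [U] are orthogonal but not normalised, so no square root is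
    taken. *)
Lemma bessel (R : realFieldType) (p n : nat) (U : 'M[R]_(p, n)) (g : 'rV[R]_p)
    (w : 'rV[R]_n) :
  U *m U^T = diag_mx g -> (forall i, g 0 i != 0) ->
  \sum_i (w *m U^T) 0 i ^+ 2 / g 0 i <= sqnorm w.
Proof.
move=> UU nzg; set b := w *m U^T.
pose c := b *m diag_mx (\row_i (g 0 i)^-1).
have cE i : c 0 i = b 0 i / g 0 i by rewrite /c mul_mx_diag !mxE.
have := sqnorm_ge0 (w - c *m U).
suff -> : sqnorm (w - c *m U) = sqnorm w - \sum_i b 0 i ^+ 2 / g 0 i.
  by rewrite subr_ge0.
rewrite /sqnorm linearB /= mulmxBl !mulmxBr trmx_mul.
rewrite -[c *m U *m (_ *m _)]mulmxA [U *m (_ *m _)]mulmxA UU.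
rewrite [w *m (_ *m _)]mulmxA -/b.
have -> : c *m U *m w^T = c *m b^T by rewrite /b trmx_mul trmxK mulmxA.
rewrite mulmxA.
have -> : c *m diag_mx g = b.
  by apply/rowP => i; rewrite mul_mx_diag mxE cE divfK.
rewrite opprB addrA subrK mxE [X in _ + X]mxE; congr (_ - _).
by rewrite mxE; apply: eq_bigr => i _; rewrite [b^T _ _]mxE cE expr2 mulrAC.
Qed.

Lemma mxtrace_gram_sum (R : realFieldType) (h n : nat) (Y : 'M[R]_(h, n)) :
  \tr (Y *m Y^T) = \sum_k sqnorm (row k Y).
Proof.
apply: eq_bigr => k _; rewrite /sqnorm !mxE.
by apply: eq_bigr => i _; rewrite !mxE.
Qed.

(** Diagonalising the Gram matrix of [T] by congruence gives orthogonal rows [u_i] in its row space.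
    Each ratio [|u_i Y^T|^2 / |u_i|^2] exceeds [a], and by Bessel on each row of [Y] the ratios sum
    to at most the trace. *)
Lemma expanding_dim_le (R : realFieldType) (p n h : nat)
    (T : 'M[R]_(p, n)) (Y : 'M[R]_(h, n)) (a : R) :
  (forall c : 'rV[R]_p, c != 0 -> a * sqnorm (c *m T) < sqnorm (c *m T *m Y^T)) ->
  a * p%:R <= \tr (Y *m Y^T).
Proof.
move=> expT.
have symG : (T *m T^T)^T = T *m T^T by rewrite trmx_mul trmxK.
have [Q unitQ [g gE]] := symmetric_congruent_diag symG.
pose U := Q *m T.
have UU : U *m U^T = diag_mx g by rewrite /U trmx_mul mulmxA -[Q *m T *m _]mulmxA.
have uE i : row i U = row i Q *m T by rewrite /U row_mul.
have gU i : g 0 i = sqnorm (row i U).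
  have := congr1 (fun M : 'M_p => M i i) UU; rewrite /= [RHS]mxE eqxx mulr1n => <-.
  by rewrite sqnormE mxE; apply: eq_bigr => j _; rewrite !mxE expr2.
have nzQ i : row i Q != 0.
  apply: contraTneq unitQ => Q0; rewrite -row_free_unit; apply/negP.
  move=> freeQ; have : delta_mx 0 i = 0 :> 'rV[R]_p.
    by apply: (row_free_inj freeQ); rewrite -rowE Q0 mul0mx.
  move=> /(congr1 (fun M : 'rV_p => M 0 i)) /eqP.
  by rewrite !mxE !eqxx oner_eq0.
have expU i : a * g 0 i < sqnorm (row i U *m Y^T).
  by rewrite gU uE; apply: expT.
(* Strictness of the expansion excludes [u_i = 0], which would give [0 < 0]. *)
have gt0 i : 0 < g 0 i.
  rewrite lt0r gU sqnorm_ge0 andbT sqnorm_eq0; apply/eqP => u0.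
  have := expU i; rewrite gU u0 mul0mx.
  by rewrite !sqnorm0 mulr0 ltxx.
rewrite mxtrace_gram_sum.
apply: le_trans (ler_sum _ (fun k _ => bessel (row k Y) UU (fun i => lt0r_neq0 (gt0 i)))).
rewrite exchange_big /= -[p in p%:R]card_ord mulr_natr -sumr_const.
apply: ler_sum => i _; rewrite -mulr_suml ler_pdivlMr //.
apply: (le_trans (ltW (expU i))); rewrite sqnormE.
suff -> : \sum_k (row i U *m Y^T) 0 k ^+ 2 = \sum_k (row k Y *m U^T) 0 i ^+ 2 by [].
apply: eq_bigr => k _; congr (_ ^+ 2); rewrite !mxE.
by apply: eq_bigr => j _; rewrite !mxE mulrC.
Qed.

(** * Subspaces on which a quadratic form is nonpositive *)

Lemma mulmx_ker_subspace (K : fieldType) (n p : nat) (C : 'M[K]_(p, n)) :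
  exists2 W : {vspace 'cV[K]_n}, (n - p <= \dim W)%N &
    forall y, y \in W -> C *m y = 0.
Proof.
pose f : 'Hom('cV[K]_n, 'cV[K]_p) := linfun (mulmx C).
exists (lker f); last first.
  by move=> y; rewrite memv_ker lfunE /= => /eqP.
rewrite leq_subLR addnC; have := limg_ker_dim f fullv.
rewrite capfv dimvf dim_matrix mulr1 => {1}<-.
rewrite leq_add2l; apply: leq_trans (dimvS (subvf _)) _.
by rewrite dimvf dim_matrix mulr1.
Qed.

(** The rows of [P] with positive coefficient span a positive definite space, so there are at most
    [m] of them; requiring those coordinates to vanish costs at most [m] dimensions. *)
Lemma symmetric_nonpos_subspace (R : realFieldType) (n m : nat) (B : 'M[R]_n) :
  B^T = B ->
  (forall (p : nat) (M : 'M[R]_(p, n)),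
     (forall c : 'rV[R]_p, c != 0 -> 0 < ((c *m M) *m B *m (c *m M)^T) 0 0) ->
     (p <= m)%N) ->
  exists2 W : {vspace 'cV[R]_n}, (n - m <= \dim W)%N &
    forall y, y \in W -> (y^T *m B *m y) 0 0 <= 0.
Proof.
move=> symB posB.
have [P unitP [d dE]] := symmetric_congruent_diag symB.
pose pos := [set i | 0 < d 0 i].
have le_pos : (#|pos| <= m)%N.
  apply: (posB _ (rowsub enum_val P)) => c nzc.
  (* [e] is [c] extended by zero outside [pos]. *)
  pose e : 'rV[R]_n := \sum_j c 0 j *: delta_mx 0 (enum_val j).
  have -> : c *m rowsub enum_val P = e *m P.
    rewrite mulmx_sum_row mulmx_suml; apply: eq_bigr => j _.
    by rewrite -scalemxAl -rowE row_rowsub.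
  rewrite trmx_mul !mulmxA -(mulmxA e) -(mulmxA e) dE quad_diag.
  have eE j : e 0 (enum_val j) = c 0 j.
    rewrite /e summxE (bigD1 j) //= !mxE !eqxx mulr1 big1 ?addr0 // => k nkj.
    by rewrite !mxE (inj_eq enum_val_inj) eq_sym (negbTE nkj) mulr0.
  have e0 i : i \notin pos -> e 0 i = 0.
    move=> npos; rewrite /e summxE big1 // => j _; rewrite !mxE.
    have [ij|] := eqVneq i (enum_val j); last by rewrite andbF mulr0.
    by rewrite ij enum_valP in npos.
  have ge0 i : 0 <= d 0 i * e 0 i ^+ 2.
    have [ipos|/e0 ->] := boolP (i \in pos); last by rewrite expr0n mulr0.
    by rewrite mulr_ge0 ?sqr_ge0 // ltW //; rewrite inE in ipos.
  rewrite lt0r sumr_ge0 // andbT psumr_eq0 //; apply: contraNN nzc => /allP all0.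
  apply/eqP/rowP => j; rewrite [RHS]mxE -eE.
  have := all0 (enum_val j) (mem_index_enum _).
  have := enum_valP j; rewrite inE => dj.
  by rewrite mulf_eq0 (gt_eqF dj) sqrf_eq0 => /eqP.
(* [C *m y] lists the coordinates of [y^T] in the basis of rows of [P] at the indices in [pos]. *)
pose C := rowsub (enum_val : 'I_#|pos| -> 'I_n) (invmx P)^T.
have [W dimW CW] := mulmx_ker_subspace C.
exists W; first by apply: leq_trans dimW; rewrite leq_sub2l.
move=> y /CW Cy0; pose x := y^T *m invmx P.
have yE : y^T = x *m P by rewrite mulmxKV.
have -> : y^T *m B *m y = x *m diag_mx d *m x^T.
  by rewrite -[y in _ *m y]trmxK yE -dE trmx_mul !mulmxA.
rewrite quad_diag; apply: sumr_le0 => i _.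
have [ipos|] := boolP (i \in pos); last first.
  by rewrite inE -leNgt => di; rewrite mulr_le0_ge0 ?sqr_ge0.
have -> : x 0 i = 0.
  have := congr1 (fun z : 'cV_ _ => z (enum_rank_in ipos i) 0) Cy0.
  rewrite /C mul_rowsub_mx !mxE enum_rankK_in // => xi.
  by rewrite -[RHS]xi; apply: eq_bigr => j _; rewrite !mxE mulrC.
by rewrite expr0n mulr0.
Qed.

(** * The matrix [B] and its factorisation *)

Lemma Bmx_gram (R : realType) (n h : nat) (v : 'I_h -> 'cV[R]_n)
    (beta : 'I_h -> R) :
  (forall k, 0 <= beta k) ->
  let X : 'M[R]_(h, n) := \matrix_(k, i) (Num.sqrt (beta k) * v k i 0) in
  Bmx v beta = X^T *m X - 2 *: diag_mx (\row_i (\sum_k X k i ^+ 2)).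
Proof.
move=> beta_ge0 X.
have XX k i j : X k i * X k j = beta k * (v k i 0 * v k j 0).
  by rewrite !mxE mulrACA -expr2 sqr_sqrtr.
have vE k i : dotv (v k) (stdb R i) = v k i 0.
  by rewrite /dotv /stdb -colE !mxE.
have diagE k : \sum_(i < n) dotv (v k) (stdb R i) ^+ 2 *: (stdb R i *m (stdb R i)^T)
    = diag_mx (\row_i v k i 0 ^+ 2).
  rewrite diag_mx_sum_delta; apply: eq_bigr => i _.
  by rewrite vE mxE /stdb trmx_delta mul_delta_mx.
apply/matrixP => i j; rewrite /Bmx summxE.
transitivity (\sum_k (X k i * X k j - 2 * ((X k i * X k i) *+ (i == j)))).
  apply: eq_bigr => k _; rewrite !XX diagE !mxE big_ord1 mxE mulrBr expr2.
  by congr (_ - _); rewrite mulrCA -mulrnAr.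
rewrite sumrB -mulr_sumr sumrMnl mxE [X in _ = X + _]mxE; congr (_ + _).
  by apply: eq_bigr => k _; rewrite [X^T _ _]mxE.
rewrite [RHS]mxE [X in _ = - X]mxE [X in _ = - (2 * X)]mxE [(\row__ _) _ _]mxE.
by under [in RHS]eq_bigr => k _ do rewrite expr2.
Qed.

Theorem theorem4 (R : realType) (n h : nat)
    (v : 'I_h -> 'cV[R]_n) (beta : 'I_h -> R)
    (beta_ge0 : forall k : 'I_h, 0 <= beta k) :
  exists W : {vspace 'cV[R]_n},
    n%:R / 2 <= (\dim W)%:R :> R /\
    (forall y : 'cV[R]_n, y \in W -> (y^T *m Bmx v beta *m y) 0 0 <= 0).
Proof.
rewrite (Bmx_gram v beta_ge0) /=; set X := \matrix_(_, _) _.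
set D := \row_i _.
pose s : 'rV[R]_n := \row_i Num.sqrt (D 0 i).
(* Division by zero yields zero, so [Y] has a zero column wherever [s] vanishes. *)
pose Y : 'M[R]_(h, n) := \matrix_(k, i) (X k i / s 0 i).
have D_ge0 i : 0 <= D 0 i by rewrite mxE sumr_ge0 // => k _; rewrite sqr_ge0.
have sD i : s 0 i ^+ 2 = D 0 i by rewrite mxE sqr_sqrtr.
have ss : diag_mx D = diag_mx s *m diag_mx s.
  by rewrite mulmx_diag; congr diag_mx; apply/rowP => i; rewrite [RHS]mxE -expr2 sD.
have XE : X = Y *m diag_mx s.
  apply/matrixP => k i; rewrite mul_mx_diag [RHS]mxE [Y k i]mxE.
  have [s0|nzs] := eqVneq (s 0 i) 0; last by rewrite divfK.
  (* Here [D 0 i = 0] is the sum of squares of column [i] of [X], which is therefore zero too. *)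
  rewrite s0 mulr0; apply/eqP; rewrite -sqrf_eq0.
  have /eqP := sD i; rewrite s0 expr0n eq_sym /D mxE psumr_eq0 => [/allP|j _].
    by move=> /(_ k (mem_index_enum k)).
  exact: sqr_ge0.
have trY : \tr (Y *m Y^T) <= n%:R.
  rewrite mxtrace_gram_sum; under eq_bigr => k _ do rewrite sqnormE.
  rewrite exchange_big /= -[n in n%:R]card_ord -sumr_const; apply: ler_sum => i _.
  have -> : \sum_k row k Y 0 i ^+ 2 = D 0 i / s 0 i ^+ 2.
    rewrite {1}/D mxE mulr_suml; apply: eq_bigr => k _.
    by rewrite [row k Y 0 i]mxE [Y k i]mxE expr_div_n.
  (* Each column of [Y] contributes 0 or 1 to the trace. *)
  rewrite sD; have [->|nzD] := eqVneq (D 0 i) 0; first by rewrite mul0r.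
  by rewrite divff.
have symB : (X^T *m X - 2 *: diag_mx D)^T = X^T *m X - 2 *: diag_mx D.
  by rewrite linearB /= linearZ /= tr_diag_mx trmx_mul trmxK.
(* The expansion factor 2 gives [2 p <= n], that is [p <= n./2] as [p] is an integer. *)
have [p M posM|W dimW nonposW] := symmetric_nonpos_subspace (m := n./2) symB.
  rewrite geq_half_double -muln2 -(ler_nat R) natrM mulrC.
  apply: le_trans trY; apply: (@expanding_dim_le _ _ _ _ (M *m diag_mx s)).
  move=> c /posM; rewrite mulmxBr mulmxBl mxE [X in _ + X]mxE subr_gt0.
  rewrite -scalemxAr -scalemxAl [X in X < _]mxE ss.
  suff [-> ->] : (c *m M *m (diag_mx s *m diag_mx s) *m (c *m M)^T) 0 0 =
      sqnorm (c *m (M *m diag_mx s)) /\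
    (c *m M *m (X^T *m X) *m (c *m M)^T) 0 0 =
      sqnorm (c *m (M *m diag_mx s) *m Y^T) by [].
  by rewrite XE /sqnorm !trmx_mul !tr_diag_mx !trmxK !mulmxA.
exists W; split => //.
(* [n - n./2] is [n / 2] rounded up, so its double is at least [n] for odd [n] as well. *)
rewrite ler_pdivrMr // -natrM ler_nat muln2; apply: leq_trans (_ : (n - n./2).*2 <= _)%N.
  by rewrite -[X in (X - _)%N]odd_double_half; lia.
by rewrite leq_double.
Qed.
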